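(* Let $T>0$ and $0<a<\infty$, let $\varphi:(-a,a)\to\mathbb{R}$ be a homeomorphism with $\varphi(0)=0$, and let $f:[0,T]\times\mathbb{R}\times\mathbb{R}\to\mathbb{R}$ be continuous. Then the boundary value problem \[ (\varphi(u'))'=f(t,u,u'),\qquad u(T)=u(0)=u'(T), \] has at least one solution.
   Context: A solution of this problem is a function $u:[0,T]\to\mathbb{R}$ of class $C^{1}$ such that $\max_{[0,T]}|u'(t)|<a$, the function $\varphi(u')$ is continuously differentiable, $(\varphi(u'(t)))'=f(t,u(t),u'(t))$ for all $t\in[0,T]$, and $u(T)=u(0)=u'(T)$. *)

(* Defs.v *)
From HB Require Import structures.
From mathcomp Require Import all_boot all_order all_algebra.
From mathcomp Require Import all_classical all_reals all_analysis.
Import Order.TTheory GRing.Theory Num.Theory numFieldNormedType.Exports.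

Set Implicit Arguments.
Unset Strict Implicit.
Unset Printing Implicit Defensive.

Local Open Scope classical_set_scope.
Local Open Scope ring_scope.

(* A function with a domain A other than the whole type is a total function
   whose values outside A are never used. *)

Definition homeomorphism {X Y : topologicalType} (A : set X) (B : set Y)
    (h : X -> Y) : Prop :=
  [/\ set_bij A B h,
      {within A, continuous h} &
      exists2 g : Y -> X,
        {within B, continuous g} & forall x, A x -> g (h x) = x].

(* The difference quotient only ranges over A: the derivative is one-sided at
   an endpoint of an interval A. It is unique if A has no isolated point. *)
Definition has_derivative_on {R : realType} (A : set R) (u du : R -> R) :
    Prop :=
  forall t, A t -> (fun s => (u s - u t) / (s - t)) @ within A t^' --> du t.

Definition C1_on {R : realType} (A : set R) (u du : R -> R) : Prop :=
  has_derivative_on A u du /\ {within A, continuous du}.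

Definition is_maximum {R : realType} (S : set R) (m : R) : Prop :=
  S m /\ ubound S m.

Definition is_solution {R : realType} (T a : R) (phi : R -> R)
    (f : R * R * R -> R) (u : R -> R) : Prop :=
  exists du dv : R -> R,
    [/\ C1_on `[0, T] u du,
        exists2 m, is_maximum [set `|du t| | t in `[0, T]] m & m < a,
        C1_on `[0, T] (phi \o du) dv,
        forall t, t \in `[0, T] -> dv t = f (t, u t, du t) &
        u T = u 0 /\ u 0 = du T].

(* Main.v *)
Require Import Defs.
From HB Require Import structures.
From mathcomp Require Import all_boot all_order all_algebra.
From mathcomp Require Import all_classical all_reals all_analysis.
From mathcomp Require Import ring lra.
Import Order.TTheory GRing.Theory Num.Theory numFieldNormedType.Exports.
Local Open Scope classical_set_scope.
Local Open Scope ring_scope.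

(* With g the inverse of phi and v = phi(u'), the problem reads u' = g v,
   v' = f(t, u, g v), u T = u 0 = g (v T).  The conditions at T prescribe both
   u and v there once c = v T is chosen, so one integrates backwards from T and
   is left with the single equation u 0 = u T in c.  Since |u'| < a, u is
   bounded as well, so f may be taken bounded by some M; for |c| > M T the sign
   of v, hence the monotonicity of u, is that dictated by c, so that u 0 - u T
   changes sign.  As the Cauchy problem need not be uniquely solvable, the
   intermediate value theorem is applied to Euler polygons instead, and the
   polygons are passed to the limit pointwise along an ultrafilter: chords of
   a polygon near s have slopes close to the vector field at s, and this
   estimate survives the limit and yields the derivatives. *)

(** * Difference estimates for sequences with prescribed slopes *)

Section DiscreteSlopes.
Variables (R : realType) (h : R) (x p : nat -> R).
Hypothesis h_ge0 : 0 <= h.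
Hypothesis x_rec : forall k, x k.+1 = x k - h * p k.

(** The left side telescopes into the sum of [h * (q - p k)] over i <= k < j, each term being at
    most [h * e] in size. The index runs against time, hence the sign in front of [q]. *)
Lemma dist_chord_le (q e : R) (i j : nat) : (i <= j)%N ->
    (forall k, (i <= k < j)%N -> `|p k - q| <= e) ->
  `|x j - x i + h * (j%:R - i%:R) * q| <= h * (j%:R - i%:R) * e.
Proof.
move=> /subnK <-; elim: (j - i)%N => [|d IH] pq.
  by rewrite add0n !subrr mulr0 !mul0r addr0 normr0.
have pe : `|p (d + i)%N - q| <= e by apply: pq; rewrite leq_addl addSn ltnSn.
have {}IH : `|x (d + i)%N - x i + h * ((d + i)%:R - i%:R) * q| <=
    h * ((d + i)%:R - i%:R) * e.
  by apply: IH => k /andP[ik kd]; apply: pq; rewrite ik addSn ltnS (ltnW kd).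
rewrite x_rec -natr1.
have -> : x (d + i)%N - h * p (d + i)%N - x i
      + h * ((d + i)%:R + 1 - i%:R) * q =
    (x (d + i)%N - x i + h * ((d + i)%:R - i%:R) * q)
      - h * (p (d + i)%N - q) by ring.
apply: le_trans (ler_normB _ _) _.
rewrite normrM (ger0_norm h_ge0).
have -> : h * ((d + i)%:R + 1 - i%:R) * e =
  h * ((d + i)%:R - i%:R) * e + h * e by ring.
by apply: lerD => //; exact: ler_wpM2l.
Qed.

Lemma dist_chord_sym_le (q e : R) (i j : nat) :
    (forall k, (minn i j <= k <= maxn i j)%N -> `|p k - q| <= e) ->
  `|x j - x i + h * (j%:R - i%:R) * q| <= h * `|j%:R - i%:R| * e.
Proof.
move=> pq; case: (leqP i j) => ij.
  rewrite [`|j%:R - _|]ger0_norm ?subr_ge0 ?ler_nat//.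
  apply: dist_chord_le => // k /andP[ik kj]; apply: pq.
  by rewrite (minn_idPl ij) (maxn_idPr ij) ik ltnW.
rewrite distrC [`|i%:R - _|]ger0_norm ?subr_ge0 ?ler_nat; last exact: ltnW.
rewrite -normrN.
have -> : - (x j - x i + h * (j%:R - i%:R) * q) =
  x i - x j + h * (i%:R - j%:R) * q by ring.
apply: dist_chord_le; first exact: ltnW.
move=> k /andP[jk ki]; apply: pq.
by rewrite (minn_idPr (ltnW ij)) (maxn_idPl (ltnW ij)) jk ltnW.
Qed.

(** Comparison with the reference slope 0 turns the chord estimate into a Lipschitz bound. *)
Lemma dist_grid_le (B : R) (i j : nat) :
  (forall k, `|p k| <= B) -> `|x j - x i| <= h * `|j%:R - i%:R| * B.
Proof.
move=> pB.
have := @dist_chord_sym_le 0 B i j (fun k _ => _).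
by rewrite mulr0 addr0; apply => k; rewrite subr0.
Qed.

Lemma grid_le (j : nat) :
  (forall k, (k < j)%N -> 0 <= p k) -> x j <= x 0%N.
Proof.
elim: j => // j IH p_ge0; rewrite x_rec.
have := IH (fun k kj => p_ge0 k (ltnW kj)).
by have := mulr_ge0 h_ge0 (p_ge0 j (ltnSn j)); lra.
Qed.

Lemma grid_ge (j : nat) :
  (forall k, (k < j)%N -> p k <= 0) -> x 0%N <= x j.
Proof.
elim: j => // j IH p_le0; rewrite x_rec.
have := IH (fun k kj => p_le0 k (ltnW kj)).
by have := mulr_ge0_le0 h_ge0 (p_le0 j (ltnSn j)); lra.
Qed.

End DiscreteSlopes.

(** * Limits along ultrafilters, one-sided derivatives and continuity *)

(** By compactness of the segment the image ultrafilter has a cluster point. It is a limit: if the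
    preimage of a neighbourhood [V] were not in [G], that of its complement would be, and [V] would
    have to meet its complement. *)
Lemma bounded_ultra_cvg (R : realType) (I : Type) (G : set_system I)
    (x : I -> R) (B : R) : UltraFilter G ->
  (\forall i \near G, `|x i| <= B) -> exists l : R, x @ G --> l.
Proof.
move=> GU xB.
have [] := @segment_compact R (- B) B (x @ G) _.
  by near=> i => /=; rewrite in_itv/= -ler_norml; near: i.
move=> l [_ cl]; exists l => V Vl.
case: (in_ultra_setVsetC (x @^-1` V) GU) => // nV.
have [y [nVy Vy]] := cl (~` V) V nV Vl.
by [].
Unshelve. all: by end_near. Qed.

(** This criterion involves no division and no strict inequality between values of [u], so it passes
    to pointwise limits. *)
Lemma has_derivative_onP (R : realType) (A : set R) (u du : R -> R) :
  (forall s, A s -> forall e, 0 < e -> exists2 d, 0 < d &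
     forall t, A t -> `|t - s| < d ->
       `|u t - u s - (t - s) * du s| <= e * `|t - s|) ->
  has_derivative_on A u du.
Proof.
move=> H s As; apply/cvgrPdist_le => e e0.
have [d d0 Hd] := H s As e e0.
rewrite near_withinE.
have : \forall t \near s^', `|t - s| < d /\ t != s.
  near=> t; split; last by near: t; exact: nbhs_dnbhs_neq.
  rewrite distrC; near: t; apply: cvg_within; exact: (@nbhsx_ballx R R s d).
apply: filterS => t [td ts] At.
have ts0 : t - s != 0 by rewrite subr_eq0.
have -> : du s - (u t - u s) / (t - s) =
  - ((u t - u s - (t - s) * du s) / (t - s)).
  by field.
by rewrite normrN normf_div ler_pdivrMr ?normr_gt0//; exact: Hd.
Unshelve. all: by end_near. Qed.

(** Near [s] the difference quotient is bounded by [K], the size of the derivative plus 1, so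
    [|t - s| < e / K] suffices. *)
Lemma has_derivative_on_continuous (R : realType) (A : set R) (u du : R -> R) :
  has_derivative_on A u du -> {within A, continuous u}.
Proof.
move=> H; apply/subspace_continuousP => s As.
apply/cvgrPdist_le => e e0.
have := H s As => /cvgrPdist_le /(_ 1 ltr01).
rewrite !near_withinE => Hd.
pose K := `|du s| + 1.
have K0 : 0 < K by rewrite /K; have := normr_ge0 (du s); lra.
have Hb : \forall t \near s, `|t - s| < e / K.
  near=> t; rewrite distrC; near: t.
  by apply: (@nbhsx_ballx R R s (e / K)); rewrite divr_gt0.
near=> t => At.
have [->|ts] := eqVneq t s; first by rewrite subrr normr0 ltW.
have ts0 : 0 < `|t - s| by rewrite normr_gt0 subr_eq0.
have h1 : `|du s - (u t - u s) / (t - s)| <= 1.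
  have : t != s -> A t -> `|du s - (u t - u s) / (t - s)| <= 1 by near: t.
  by apply.
have h2 : `|t - s| < e / K by near: t.
have h3 : `|(u t - u s) / (t - s)| <= K.
  rewrite /K -lerBlDl; apply: le_trans (lerB_dist _ _) _.
  by rewrite distrC.
move: h3; rewrite normf_div ler_pdivrMr// distrC => /le_trans; apply.
by rewrite mulrC -ler_pdivlMr// ltW.
Unshelve. all: by end_near. Qed.

Lemma continuous3_dist_le (R : realType) (F : R * R * R -> R) (t x y e : R) :
    {for (t, x, y), continuous F} -> 0 < e ->
  exists2 d, 0 < d & forall t' x' y', `|t' - t| < d -> `|x' - x| < d ->
    `|y' - y| < d -> `|F (t', x', y') - F (t, x, y)| <= e.
Proof.
move=> /cvgrPdist_le /[apply] /nbhs_ballP[d /= d0 Hd]; exists d => // t' x' y'.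
move=> h1 h2 h3; rewrite distrC; apply: Hd.
by split => /=; [split => /=|]; rewrite /ball /= distrC.
Qed.

Lemma continuous3_cvg (R : realType) (I : Type) (G : set_system I)
    (GF : Filter G) (F : R * R * R -> R) (f1 f2 f3 : I -> R) (t x y : R) :
  {for (t, x, y), continuous F} ->
  f1 @ G --> t -> f2 @ G --> x -> f3 @ G --> y ->
  F (f1 i, f2 i, f3 i) @[i --> G] --> F (t, x, y).
Proof.
move=> Fc f1t f2x f3y; apply/cvgrPdist_le => e e0.
have [d d0 Fd] := continuous3_dist_le _ _ _ _ _ _ Fc e0.
near=> i; rewrite distrC; apply: Fd; near: i.
- exact: cvgr_distC_lt f1t _ d0.
- exact: cvgr_distC_lt f2x _ d0.
- exact: cvgr_distC_lt f3y _ d0.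
Unshelve. all: by end_near. Qed.

(** * Uniform grids run backwards from T, and limits of polygons *)

Section BackwardGrid.
Context {R : realType} (T : R).
Hypothesis T_gt0 : 0 < T.

Definition mesh (n : nat) : R := T / n.+1%:R.

(** For t <= T this is the last step, counted backwards from T, whose time has not gone below t:
    that time lies in [t, t + mesh n). *)
Definition node (n : nat) (t : R) : nat := Num.truncn ((T - t) / mesh n).

Lemma mesh_gt0 n : 0 < mesh n.
Proof. by rewrite divr_gt0. Qed.

Lemma mesh_near (e : R) : 0 < e -> \forall n \near \oo, mesh n < e.
Proof.
move=> e0.
have eT : 0 < e / T by rewrite divr_gt0.
have := near_infty_natSinv_lt (PosNum eT); apply: filterS => n /=.
by rewrite /mesh ltr_pdivlMr// mulrC.
Qed.

Lemma node_itv n t : t <= T -> 0 <= T - t - mesh n * (node n t)%:R < mesh n.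
Proof.
move=> tT; have m0 := mesh_gt0 n.
have q0 : 0 <= (T - t) / mesh n.
  by rewrite divr_ge0 ?subr_ge0// ltW.
have := truncn_itv q0; rewrite -/(node n t) ler_pdivlMr// ltr_pdivrMr//.
rewrite -natr1 => /andP[h1 h2]; apply/andP; split; lra.
Qed.

Lemma node_T n : node n T = 0%N.
Proof. by rewrite /node subrr mul0r truncn0. Qed.

Lemma node_0 n : node n 0 = n.+1.
Proof.
rewrite /node subr0 /mesh invf_div mulrCA divff ?mulr1 ?natrK//.
by rewrite gt_eqF.
Qed.

Lemma node_le n t : 0 <= t <= T -> (node n t <= n.+1)%N.
Proof.
move=> /andP[t0 tT].
have /andP[h1 _] := node_itv n _ tT.
rewrite -(ler_nat R) -(ler_pM2l (mesh_gt0 n)).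
have -> : mesh n * n.+1%:R = T by rewrite /mesh divfK.
lra.
Qed.

Variables (G : set_system nat).
Context {GF : ProperFilter G}.
Hypothesis G_oo : \oo `<=` G.

(** The slopes at all nodes near [s] are eventually close to [P s], so chords near [s] obey the
    estimate of [has_derivative_onP] up to an error of order [mesh n], which vanishes in the
    limit. *)
Lemma grid_limit_has_derivative (x p : nat -> nat -> R) (X P : R -> R) :
    (forall n k, x n k.+1 = x n k - mesh n * p n k) ->
    (forall t, t \in `[0, T] -> x n (node n t) @[n --> G] --> X t) ->
    (forall s, s \in `[0, T] -> forall e, 0 < e -> exists2 d, 0 < d &
       \forall n \near G, forall k, `|T - mesh n * k%:R - s| < d ->
         `|p n k - P s| <= e) ->
  has_derivative_on `[0, T] X P.
Proof.
move=> x_rec x_cvg p_cvg; apply: has_derivative_onP => s s0T e e0.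
have [d d0 pd] := p_cvg s s0T e e0.
(* With [mesh n < d / 2] as well, every node between those of [s] and [t] lies within [d] of [s]. *)
exists (d / 2) => [|t t0T tsd]; first by rewrite divr_gt0.
apply/ler_addgt0Pr => eta eta0.
(* Replacing [s] and [t] by their nodes costs at most [mesh n * K], which [eta] absorbs. *)
pose K := e + `|P s|.
have K0 : 0 < K by rewrite /K; have := normr_ge0 (P s); lra.
apply: (@cvgr_to_le _ G _ R
    (fun n => `|x n (node n t) - x n (node n s) - (t - s) * P s|)).
  apply: cvg_norm; apply: cvgB; last exact: cvg_cst.
  by apply: cvgB; exact: x_cvg.
near=> n.
have hd : mesh n < d / 2 by near: n; apply: G_oo; apply: mesh_near; lra.
have heta : mesh n < eta / K.
  by near: n; apply: G_oo; apply: mesh_near; rewrite divr_gt0.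
have pn : forall k, `|T - mesh n * k%:R - s| < d -> `|p n k - P s| <= e.
  by near: n.
have h0 := mesh_gt0 n.
move: s0T t0T; rewrite /= !in_itv/= => /andP[s0 sT] /andP[t0 tT].
have /andP[s1 s2] := node_itv n _ sT.
have /andP[t1 t2] := node_itv n _ tT.
set i := node n s in s1 s2 *; set j := node n t in t1 t2 *.
have near_s k : (minn i j <= k <= maxn i j)%N -> `|p n k - P s| <= e.
  move=> /andP[ik kj]; apply: pn.
  have {}ik : mesh n * (minn i j)%:R <= mesh n * k%:R.
    by rewrite ler_pM2l// ler_nat.
  have {}kj : mesh n * k%:R <= mesh n * (maxn i j)%:R.
    by rewrite ler_pM2l// ler_nat.
  move: ik kj; have := ler_norm (t - s); have := ler_norm (s - t).
  rewrite (distrC s t) ltr_norml /minn /maxn; case: ltnP => _ *;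
    apply/andP; split; lra.
have := @dist_chord_sym_le R (mesh n) (x n) (p n) (ltW h0) (x_rec n) (P s) e
  i j near_s.
have -> : mesh n * `|j%:R - i%:R| = `|mesh n * j%:R - mesh n * i%:R|.
  by rewrite -mulrBr normrM gtr0_norm.
have -> : mesh n * (j%:R - i%:R) = mesh n * j%:R - mesh n * i%:R.
  by rewrite mulrBr.
set a := mesh n * i%:R in s1 s2 *; set b := mesh n * j%:R in t1 t2 *.
move=> main.
have r1 : `|b - a - (s - t)| <= mesh n.
  by rewrite ler_norml; apply/andP; split; lra.
have r2 : `|b - a| <= `|t - s| + mesh n.
  have -> : b - a = (b - a - (s - t)) - (t - s) by ring.
  by apply: le_trans (ler_normB _ _) _; rewrite addrC lerD2l.
have -> : x n j - x n i - (t - s) * P s =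
  (x n j - x n i + (b - a) * P s) - (b - a - (s - t)) * P s by ring.
apply: le_trans (ler_normB _ _) _; rewrite normrM.
move: heta; rewrite ltr_pdivlMr// /K => heta.
have := ler_wpM2r (ltW e0) r2.
have := ler_wpM2r (normr_ge0 (P s)) r1.
by lra.
Unshelve. all: by end_near. Qed.

End BackwardGrid.

(** * Shooting with Euler polygons for a bounded vector field *)

Section Shooting.
Variables (R : realType) (T a M : R) (g : R -> R) (F : R * R * R -> R).
Hypothesis T_gt0 : 0 < T.
Hypothesis g_cont : continuous g.
Hypothesis g_le : forall v, `|g v| <= a.
Hypothesis g_sign :
  (forall v, 0 <= v * g v) \/ (forall v, v * g v <= 0).
Hypothesis F_cont : continuous F.
Hypothesis F_le : forall X, `|F X| <= M.

(* The value after k steps approximates (u, v) at time T - h k. *)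
Fixpoint euler (h c : R) (k : nat) : R * R :=
  if k is j.+1 then
    let X := euler h c j in
    (X.1 - h * g X.2, X.2 - h * F (T - h * j%:R, X.1, X.2))
  else (g c, c).

(** For a fixed number of steps the polygon depends continuously on the shooting parameter, as a
    solution of the Cauchy problem need not. *)
Lemma euler_continuous h k :
  continuous (fun c => (euler h c k).1) /\
  continuous (fun c => (euler h c k).2).
Proof.
elim: k => [|k [IH1 IH2]] /=; first by split => //; move=> ?; exact: cvg_id.
split => c.
  apply: cvgB; first exact: IH1.
  apply: cvgM; first exact: cvg_cst.
  by apply: continuous_cvg; [exact: g_cont | exact: IH2].
apply: cvgB; first exact: IH2.
apply: cvgM; first exact: cvg_cst.
apply: continuous3_cvg; first exact: F_cont.
- exact: cvg_cst.
- exact: IH1.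
- exact: IH2.
Qed.

(** The Lipschitz constants [a] and [M] are independent of step size and parameter; this gives both
    the bounds and the equicontinuity used in the limit. *)
Lemma dist_euler_le h c i j : 0 <= h ->
  `|(euler h c j).1 - (euler h c i).1| <= h * `|j%:R - i%:R| * a /\
  `|(euler h c j).2 - (euler h c i).2| <= h * `|j%:R - i%:R| * M.
Proof.
move=> h0; split.
- exact: (@dist_grid_le R h (fun k => (euler h c k).1)
    (fun k => g (euler h c k).2)).
- exact: (@dist_grid_le R h (fun k => (euler h c k).2)
    (fun k => F (T - h * k%:R, (euler h c k).1, (euler h c k).2))).
Qed.

(* If |c| exceeds M T then the second component keeps the sign of c, so the
   first one is monotone; the two signs of c give opposite monotonicities. *)
Lemma euler_shooting n : exists2 c, `|c| <= M * T + 1 &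
  (euler (mesh T n) c n.+1).1 = g c.
Proof.
have M0 : 0 <= M by apply: le_trans (F_le (0, 0, 0)).
have h0 := ltW (mesh_gt0 T T_gt0 n).
set h := mesh T n in h0 *.
(* The second component drifts by at most [M * T] over the whole grid, so from [C] or [- C] it stays
   at distance at least 1 from 0. *)
set C := M * T + 1.
have C0 : 0 <= C by rewrite /C addr_ge0// mulr_ge0// ltW.
have drift c k : (k <= n.+1)%N -> `|(euler h c k).2 - c| <= M * T.
  move=> kn; have [_] := dist_euler_le h c 0 k h0.
  rewrite subr0 normr_nat => /le_trans; apply.
  rewrite mulrC; apply: ler_wpM2l => //.
  have -> : T = h * n.+1%:R by rewrite /h /mesh divfK.
  by apply: ler_wpM2l => //; rewrite ler_nat.
have pos k : (k < n.+1)%N -> 0 < (euler h C k).2.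
  move=> kn; have := drift C k (ltnW kn).
  by rewrite ler_norml /C => /andP[]; lra.
have neg k : (k < n.+1)%N -> (euler h (- C) k).2 < 0.
  move=> kn; have := drift (- C) k (ltnW kn).
  by rewrite ler_norml /C => /andP[]; lra.
pose D c := (euler h c n.+1).1 - g c.
have D_cont : {within `[- C, C], continuous D}.
  apply: continuous_subspaceT => c; apply: cvgB; last exact: g_cont.
  by have [+ _] := euler_continuous h n.+1; apply.
have monE c k : (euler h c k.+1).1 = (euler h c k).1 - h * g (euler h c k).2.
  by [].
(* [D] is the last minus the initial value of the first component. Which end carries which sign
   depends on [g_sign], hence the min and max. *)
have DE : Num.min (D (- C)) (D C) <= 0 <= Num.max (D (- C)) (D C).
  rewrite ge_min le_max /D !subr_le0 !subr_ge0.
  case: g_sign => gs.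
  - have -> : (euler h C n.+1).1 <= g C.
      apply: (@grid_le R h _ _ h0 (monE C)) => k kn.
      by have := gs (euler h C k).2; rewrite pmulr_rge0//; exact: pos.
    have -> : g (- C) <= (euler h (- C) n.+1).1.
      apply: (@grid_ge R h _ _ h0 (monE (- C))) => k kn.
      by have := gs (euler h (- C) k).2; rewrite nmulr_rge0//; exact: neg.
    by rewrite orbT.
  - have -> : g C <= (euler h C n.+1).1.
      apply: (@grid_ge R h _ _ h0 (monE C)) => k kn.
      by have := gs (euler h C k).2; rewrite pmulr_rle0//; exact: pos.
    have -> : (euler h (- C) n.+1).1 <= g (- C).
      apply: (@grid_le R h _ _ h0 (monE (- C))) => k kn.
      by have := gs (euler h (- C) k).2; rewrite nmulr_rle0//; exact: neg.
    by rewrite orbT.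
have CC : - C <= C by lra.
have [c] := IVT CC D_cont DE.
rewrite in_itv/= -ler_norml => cC /eqP; rewrite subr_eq0 => /eqP cE.
by exists c.
Qed.

Lemma shooting : exists u v : R -> R,
  [/\ has_derivative_on `[0, T] u (g \o v),
      has_derivative_on `[0, T] v (fun t => F (t, u t, v t)),
      u T = g (v T), u 0 = u T &
      forall t, t \in `[0, T] -> `|u t| <= a + T * a].
Proof.
have M0 : 0 <= M by apply: le_trans (F_le (0, 0, 0)).
have a0 : 0 <= a by apply: le_trans (g_le 0).
have [c c_le c_eq] : exists2 c : nat -> R, (forall n, `|c n| <= M * T + 1) &
    forall n, (euler (mesh T n) (c n) n.+1).1 = g (c n).
  have /choice[c Hc] n : exists c, `|c| <= M * T + 1 /\
      (euler (mesh T n) c n.+1).1 = g c.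
    by have [c] := euler_shooting n; exists c.
  by exists c => n; have [] := Hc n.
(* A single ultrafilter refining [\oo] gives limits at all times at once, in place of a diagonal
   subsequence. *)
have [G [GU G_oo]] := ultraFilterLemma (F := \oo) _.
pose U n k := (euler (mesh T n) (c n) k).1.
pose V n k := (euler (mesh T n) (c n) k).2.
have Ttn n t : t \in `[0, T] -> mesh T n * `|(node T n t)%:R - 0| <= T.
  rewrite in_itv/= => tT; rewrite subr0 normr_nat.
  rewrite -[leRHS](@divfK _ n.+1%:R)// ler_wpM2l//.
    exact/ltW/(mesh_gt0 T T_gt0).
  by rewrite ler_nat (node_le T T_gt0).
have U_le n t : t \in `[0, T] -> `|U n (node T n t)| <= a + T * a.
  move=> tT; have [h1 _] :=
    dist_euler_le (mesh T n) (c n) 0 (node T n t) (ltW (mesh_gt0 T T_gt0 n)).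
  rewrite -[U _ _](subrK (g (c n))); apply: le_trans (ler_normD _ _) _.
  rewrite addrC lerD//; apply: le_trans h1 _.
  by apply: ler_wpM2r => //; exact: Ttn.
have V_le n t : t \in `[0, T] ->
    `|V n (node T n t)| <= M * T + 1 + T * M.
  move=> tT; have [_ h1] :=
    dist_euler_le (mesh T n) (c n) 0 (node T n t) (ltW (mesh_gt0 T T_gt0 n)).
  rewrite -[V _ _](subrK (c n)); apply: le_trans (ler_normD _ _) _.
  rewrite addrC lerD//; apply: le_trans h1 _.
  by apply: ler_wpM2r => //; exact: Ttn.
(* Outside [0, T] the value 0 is an arbitrary default. *)
have /choice[u u_cvg] t : exists l : R,
    t \in `[0, T] -> U n (node T n t) @[n --> G] --> l.
  have [tT|tT] := boolP (t \in `[0, T]); last by exists 0.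
  have [|l] := @bounded_ultra_cvg R nat G (fun n => U n (node T n t))
    (a + T * a) GU; last by exists l.
  by apply: nearW => n; exact: U_le.
have /choice[v v_cvg] t : exists l : R,
    t \in `[0, T] -> V n (node T n t) @[n --> G] --> l.
  have [tT|tT] := boolP (t \in `[0, T]); last by exists 0.
  have [|l] := @bounded_ultra_cvg R nat G (fun n => V n (node T n t))
    (M * T + 1 + T * M) GU; last by exists l.
  by apply: nearW => n; exact: V_le.
have T0T : T \in `[0, T] by rewrite in_itv/= lexx ltW.
have O0T : 0 \in `[0, T] by rewrite in_itv/= lexx ltW.
have GF : ProperFilter G by exact: ultra_proper.
(* Convergence at the node of [s] costs [d / 2]. A node within [d'] of [s] is within [2 * d'] of
   that node, so the Lipschitz bounds cost less than the other half; the 1 in [K] also gives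
   [d' < d]. *)
have UV_near s d : s \in `[0, T] -> 0 < d -> exists2 d', 0 < d' &
    \forall n \near G, forall k, `|T - mesh T n * k%:R - s| < d' ->
      [/\ `|T - mesh T n * k%:R - s| < d, `|U n k - u s| < d &
          `|V n k - v s| < d].
  move=> s0T d0; pose K := a + M + 1.
  have K0 : 0 < K by rewrite /K; lra.
  pose d' := d / (4 * K).
  have d'0 : 0 < d' by rewrite divr_gt0// mulr_gt0.
  have d'K : d = 4 * (d' * K) by rewrite /d'; field; rewrite gt_eqF.
  have d'd : d' < d.
    rewrite d'K; have : d' * 1 <= d' * K by rewrite ler_pM2l// /K; lra.
    lra.
  exists d' => //.
  have u_near : \forall n \near G, `|u s - U n (node T n s)| < d / 2.
    by apply: cvgr_dist_lt; [exact: u_cvg | lra].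
  have v_near : \forall n \near G, `|v s - V n (node T n s)| < d / 2.
    by apply: cvgr_dist_lt; [exact: v_cvg | lra].
  near=> n => k kd'.
  have hd' : mesh T n < d' by near: n; apply: G_oo; exact: mesh_near.
  have h0 := mesh_gt0 T T_gt0 n.
  move: (s0T); rewrite in_itv/= => /andP[s0 sT].
  have /andP[n1 n2] := node_itv T T_gt0 n _ sT.
  have ik : mesh T n * `|k%:R - (node T n s)%:R| <= 2 * d'.
    rewrite -[X in X * _](gtr0_norm h0) -normrM mulrBr ler_norml.
    by move: kd'; rewrite ltr_norml => /andP[? ?]; apply/andP; split; lra.
  have [hU hV] := dist_euler_le (mesh T n) (c n) (node T n s) k (ltW h0).
  have := ler_wpM2r a0 ik; have := ler_wpM2r M0 ik.
  have un : `|u s - U n (node T n s)| < d / 2 by near: n.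
  have vn : `|v s - V n (node T n s)| < d / 2 by near: n.
  have aK : 2 * d' * a + 2 * d' * M + 2 * d' = d / 2.
    by rewrite d'K /K; field.
  have ad : 0 <= d' * a by rewrite mulr_ge0// ltW.
  have Md : 0 <= d' * M by rewrite mulr_ge0// ltW.
  move=> hM ha; split; first exact: lt_trans kd' d'd.
  - apply: le_lt_trans (ler_distD (U n (node T n s)) _ _) _.
    by rewrite (distrC (U n _) (u s)); rewrite -/(U _ _) -/(U _ _) in hU; lra.
  - apply: le_lt_trans (ler_distD (V n (node T n s)) _ _) _.
    by rewrite (distrC (V n _) (v s)); rewrite -/(V _ _) -/(V _ _) in hV; lra.
(* At time T the polygon is at step 0, and at time 0 at step n+1, where [c_eq] returns [g (c n)].
   Thus [u T], [u 0] and [g (v T)] are limits of one sequence. *)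
have uT : g (c n) @[n --> G] --> u T.
  have := u_cvg T T0T; rewrite (_ : (fun n => U n (node T n T)) = g \o c)//.
  by apply/funext => n; rewrite node_T.
have vT : c n @[n --> G] --> v T.
  have := v_cvg T T0T; rewrite (_ : (fun n => V n (node T n T)) = c)//.
  by apply/funext => n; rewrite node_T.
have u0 : g (c n) @[n --> G] --> u 0.
  have := u_cvg 0 O0T; rewrite (_ : (fun n => U n (node T n 0)) = g \o c)//.
  by apply/funext => n; rewrite node_0// /U c_eq.
exists u, v; split.
- apply: (grid_limit_has_derivative T T_gt0 G G_oo U
    (fun n k => g (V n k))) => // s s0T e e0.
  have /cvgrPdist_le/(_ e e0)/nbhs_ballP[d /= d0 gd] := g_cont (v s).
  have [d' d'0 near_d'] := UV_near s d s0T d0.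
  exists d' => //; apply: filterS near_d' => n near_n k /near_n[_ _ Vd].
  by rewrite distrC; apply: gd; rewrite /ball/= distrC.
- apply: (grid_limit_has_derivative T T_gt0 G G_oo V
    (fun n k => F (T - mesh T n * k%:R, U n k, V n k))) => // s s0T e e0.
  have [d d0 Fd] := continuous3_dist_le R F s (u s) (v s) e (F_cont _) e0.
  have [d' d'0 near_d'] := UV_near s d s0T d0.
  exists d' => //; apply: filterS near_d' => n near_n k /near_n[td Ud Vd].
  exact: Fd.
- exact: norm_cvg_unique uT (continuous_cvg _ (g_cont _) vT).
- exact: norm_cvg_unique u0 uT.
- move=> t tT; apply: (@cvgr_to_le _ G _ R (fun n => `|U n (node T n t)|)).
    by apply: cvg_norm; exact: u_cvg.
  by apply: nearW => n; exact: U_le.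
Unshelve. all: by end_near. Qed.

End Shooting.

(** * Truncation, relative continuity and the sign of the inverse *)

Definition clamp {R : realType} (lo hi x : R) : R := Num.max lo (Num.min x hi).

Lemma clamp_itv (R : realType) (lo hi x : R) :
  lo <= hi -> clamp lo hi x \in `[lo, hi].
Proof.
by move=> lohi; rewrite in_itv/= le_max lexx ge_max lohi ge_min lexx orbT.
Qed.

Lemma clamp_id (R : realType) (lo hi x : R) :
  x \in `[lo, hi] -> clamp lo hi x = x.
Proof.
rewrite in_itv/= => /andP[lox xhi].
by rewrite /clamp (min_idPl xhi) (max_idPr lox).
Qed.

Lemma clamp_continuous (R : realType) (lo hi : R) : continuous (clamp lo hi).
Proof.
move=> x.
apply: (@continuous_max R R (fun=> lo) (fun y => Num.min y hi)).
  exact: cvg_cst.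
by apply: (@continuous_min R R id (fun=> hi)); [exact: cvg_id | exact: cvg_cst].
Qed.

Lemma pair_continuous (X Y Z : topologicalType) (f : X -> Y) (g : X -> Z) :
  continuous f -> continuous g -> continuous (fun x => (f x, g x)).
Proof.
move=> f_cont g_cont x.
exact: (@cvg_pair _ _ _ _ (nbhs (f x)) (nbhs (g x)) _ _ _ _ _
  (f_cont x) (g_cont x)).
Qed.

(** Precomposition with a continuous map into [D] makes a function continuous only on [D] globally
    continuous, as the shooting argument requires. *)
Lemma within_comp_continuous (X Y Z : topologicalType) (D : set Y) (f : Y -> Z)
    (q : X -> Y) :
  {within D, continuous f} -> continuous q -> (forall x, D (q x)) ->
  continuous (f \o q).
Proof.
move=> /subspace_continuousP f_cont q_cont qD x.
have q_within : q @ x --> within D (nbhs (q x)).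
  by move=> V /= /q_cont; apply: (@filterS X (nbhs x)) => z; apply; exact: qD.
exact: cvg_comp q_within (f_cont _ (qD x)).
Qed.

Lemma compact_within_bounded (R : realType) (X : topologicalType) (D : set X)
    (f : X -> R) :
  compact D -> {within D, continuous f} ->
  exists M, forall x, D x -> `|f x| <= M.
Proof.
move=> Dc fc; have := compact_bounded (continuous_compact fc Dc).
move=> /pinfty_ex_gt0[M _ fM]; exists M => x Dx.
by apply: fM; exists x.
Qed.

(** A continuous injection of the line is strictly monotone; as it vanishes at 0, the two
    alternatives are the increasing and the decreasing case. *)
Lemma continuous_inj_sign (R : realType) (g : R -> R) :
  continuous g -> injective g -> g 0 = 0 ->
  (forall v, 0 <= v * g v) \/ (forall v, v * g v <= 0).
Proof.
move=> g_cont g_inj g0.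
have [g_mono|g_mono] : unstable.strict_monotonic `]-oo, +oo[ g.
- apply: itv_continuous_inj_mono => [|x y _ _ /g_inj//].
  exact: continuous_subspaceT.
- left => v; have [v0|v0|->] := ltgtP v 0; last by rewrite mul0r.
  + apply: mulr_le0; first exact: ltW.
    by rewrite -g0 ltW// g_mono// in_itv.
  + apply: mulr_ge0; first exact: ltW.
    by rewrite -g0 ltW// g_mono// in_itv.
- right => v; have [v0|v0|->] := ltgtP v 0; last by rewrite mul0r.
  + apply: mulr_le0_ge0; first exact: ltW.
    by rewrite -g0 ltW// g_mono// in_itv.
  + apply: mulr_ge0_le0; first exact: ltW.
    by rewrite -g0 ltW// g_mono// in_itv.
Qed.

(** * Reduction of the boundary value problem to a bounded system *)

Theorem theorem4p3 (R : realType) (T a : R) (phi : R -> R)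
    (f : R * R * R -> R)
    (T_gt0 : 0 < T) (a_gt0 : 0 < a)
    (phi_homeo : homeomorphism `]- a, a[ [set: R] phi)
    (phi0 : phi 0 = 0)
    (f_cont : {within `[0, T] `*` [set: R] `*` [set: R], continuous f}) :
  exists u : R -> R, is_solution T a phi f u.
Proof.
case: phi_homeo => [[_ _ phi_surj] _ [g g_contT phiK]].
have g_cont : continuous g.
  by apply/continuous_subspace_setT.
have [g_lt gK] : (forall y, `|g y| < a) /\ cancel g phi.
  split => y; have [x xA <-] := phi_surj y I; rewrite phiK//.
  by move: xA; rewrite /= in_itv/= ltr_norml.
have g0 : g 0 = 0.
  by rewrite -phi0 phiK//= in_itv/= a_gt0 oppr_lt0 a_gt0.
have g_le v : `|g v| <= a by exact: ltW.
(* A priori bound for u: its value at T is at most [a] in size, and so is its slope over a time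
   T. *)
pose K := a + T * a.
have K0 : 0 <= K by rewrite addr_ge0 ?mulr_ge0 ?ltW.
(* [q] sends (t, u, v) to arguments (t, u, u') of [f], truncated into the compact box [Q]; hence
   [f \o q] is bounded and continuous everywhere. *)
pose q (X : R * R * R) :=
  (clamp 0 T X.1.1, clamp (- K) K X.1.2, g X.2).
pose Q := `[0, T]%classic `*` `[- K, K]%classic `*` `[- a, a]%classic.
have q_cont : continuous q.
  apply: pair_continuous; first apply: pair_continuous.
  - move=> X.
    apply: (@continuous_comp _ _ _ (fst \o fst)); last exact: clamp_continuous.
    by apply: (@continuous_comp _ _ _ fst fst); exact: cvg_fst.
  - move=> X.
    apply: (@continuous_comp _ _ _ (snd \o fst)); last exact: clamp_continuous.
    by apply: (@continuous_comp _ _ _ fst snd); [exact: cvg_fst|exact: cvg_snd].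
  - move=> X.
    by apply: (@continuous_comp _ _ _ snd); [exact: cvg_snd|exact: g_cont].
have qQ X : Q (q X).
  split; first split => /=.
  - by apply: clamp_itv; exact: ltW.
  - by apply: clamp_itv; lra.
  - by rewrite /= in_itv/= -ler_norml.
have fQ : {within Q, continuous f}.
  by apply: continuous_subspaceW f_cont => X [[]].
have [M fM] : exists M, forall X, Q X -> `|f X| <= M.
  apply: compact_within_bounded fQ.
  by do 2?apply: compact_setX; exact: segment_compact.
have [u [v [u_der v_der uT u0 uK]]] := shooting R T a M g (f \o q)
  T_gt0 g_cont g_le
  (continuous_inj_sign R g g_cont (can_inj gK) g0)
  (within_comp_continuous _ _ _ _ _ _ fQ q_cont qQ)
  (fun X => fM _ (qQ X)).
have u_cont := has_derivative_on_continuous _ _ _ _ u_der.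
have v_cont := has_derivative_on_continuous _ _ _ _ v_der.
have du_cont : {within `[0, T], continuous (g \o v)}.
  apply/subspace_continuousP => t tT; apply: continuous_cvg (g_cont _) _.
  by move/subspace_continuousP: v_cont; apply.
have norm_du_cont : {within `[0, T], continuous (fun t => `|g (v t)|)}.
  apply/subspace_continuousP => t tT; apply: cvg_norm.
  by move/subspace_continuousP: du_cont; apply.
exists u, (g \o v), (fun t => f (q (t, u t, v t))); split.
- by split.
(* The maximum is attained, so the pointwise strict bound [g_lt] makes it smaller than [a]. *)
- have [t0 t0T t0max] := EVT_max (ltW T_gt0) norm_du_cont.
  exists `|g (v t0)| => //; split; first by exists t0.
  by move=> _ [t tT <-]; exact: t0max.
- have -> : phi \o (g \o v) = v by apply/funext => t /=; exact: gK.
  split=> //.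
  apply/subspace_continuousP => t tT.
  apply: (continuous3_cvg _ _ _ _ (f \o q)).
  + exact: (within_comp_continuous _ _ _ _ _ _ fQ q_cont qQ).
  + by apply: cvg_within.
  + by move/subspace_continuousP: u_cont; apply.
  + by move/subspace_continuousP: v_cont; apply.
(* Along the solution the truncations are inactive, by the a priori bound [uK]. *)
- move=> t tT; rewrite /q /= !clamp_id// in_itv/= -ler_norml.
  exact: uK.
- by rewrite u0; split => //; rewrite uT.
Qed.
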